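(* Let $S \in GL_n(\mathbb{R})$ be a Perron similarity with rows $r_1,\dots,r_n$, and suppose that $r_i = e^\top$ for some $i \in \{1,\dots,n\}$, where $e \in \mathbb{R}^n$ is the all-ones vector. Then $\mathcal{C}(S) = \mathcal{C}_r(S)$ if and only if $S$ is row Hadamard conic.
   Context: All inequalities between matrices or vectors are entrywise. A matrix $S \in GL_n(\mathbb{R})$ is called a Perron similarity if there is a real, diagonal, nonscalar matrix $D$ (i.e. $D$ is not a scalar multiple of the identity) such that $S D S^{-1} \geq 0$. For $x \in \mathbb{R}^n$, $\operatorname{diag}(x)$ denotes the diagonal matrix with diagonal entries the entries of $x$. The spectracone of $S$ is $\mathcal{C}(S) := \{x \in \mathbb{R}^n : S \operatorname{diag}(x) S^{-1} \geq 0\}$. The row cone $\mathcal{C}_r(S)$ is the convex cone generated by the rows of $S$, i.e. the set of all linear combinations of the rows of $S$ with nonnegative coefficients. Row vectors and column vectors of length $n$ are identified when comparing $\mathcal{C}_r(S)$ and $\mathcal{C}(S)$ as subsets of $\mathbb{R}^n$. With $\circ$ denoting the Hadamard (entrywise) product, $S$ is called row Hadamard conic (RHC) if $r_i \circ r_j \in \mathcal{C}_r(S)$ for all $i,j \in \{1,\dots,n\}$. *)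

(* Defs.v *)
From mathcomp Require Import all_boot all_order all_algebra.
From mathcomp Require Import classical_sets reals.

Set Implicit Arguments.
Unset Strict Implicit.
Unset Printing Implicit Defensive.

Import Order.TTheory GRing.Theory Num.Theory.
Local Open Scope ring_scope.
Local Open Scope classical_set_scope.

(* Row and column vectors of length n are identified: R^n is 'rV[R]_n throughout. *)

Definition perron_similarity (R : realType) (n : nat) (S : 'M[R]_n) : Prop :=
  S \in unitmx /\
  exists D : 'M[R]_n,
    [/\ is_diag_mx D, ~~ is_scalar_mx D
      & S *m D *m invmx S \is a mxOver Num.nneg].

Definition spectracone (R : realType) (n : nat) (S : 'M[R]_n) : set 'rV[R]_n :=
  [set x | S *m diag_mx x *m invmx S \is a mxOver Num.nneg].

Definition row_cone (R : realType) (n : nat) (S : 'M[R]_n) : set 'rV[R]_n :=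
  [set x | exists2 c : 'I_n -> R,
    (forall i, 0 <= c i) & x = \sum_(i < n) c i *: row i S].

Definition hadamard (R : realType) (m n : nat) (A B : 'M[R]_(m, n)) :
  'M[R]_(m, n) := map2_mx *%R A B.

Definition row_hadamard_conic (R : realType) (n : nat) (S : 'M[R]_n) : Prop :=
  forall i j : 'I_n, row_cone S (hadamard (row i S) (row j S)).

(* Main.v *)
(** A point x lies in the spectracone iff r_i ∘ x lies in the row cone for every
    row r_i, because the i-th row of S diag(x) S^-1 lists the coordinates of
    r_i ∘ x in the basis of rows. Taking r_i = e shows that the spectracone is
    always contained in the row cone; row Hadamard conicity says exactly that
    the spectracone contains the rows, hence, by convexity, the row cone. *)

Require Import Defs.
From mathcomp Require Import all_boot all_order all_algebra.
From mathcomp Require Import classical_sets reals.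

Import Order.TTheory GRing.Theory Num.Theory.
Local Open Scope ring_scope.
Local Open Scope classical_set_scope.

(** The rows of an invertible [S] form a basis, so the coefficients [c] are forced: they are the
    entries of [x *m invmx S]. *)
Lemma row_coneP (R : realType) (n : nat) (S : 'M[R]_n) (x : 'rV[R]_n) :
  S \in unitmx ->
  row_cone S x <-> x *m invmx S \is a mxOver Num.nneg.
Proof.
move=> uS; split=> [[c c_ge0 ->]|/mxOverP x_ge0].
  have -> : \sum_(i < n) c i *: row i S = (\row_i c i) *m S.
    by rewrite mulmx_sum_row; apply: eq_bigr => i _; rewrite mxE.
  by rewrite mulmxK //; apply/mxOverP => i j; rewrite mxE nnegrE.
exists (fun i => (x *m invmx S) 0 i); first by move=> i; rewrite -nnegrE.
by rewrite -mulmx_sum_row mulmxKV.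
Qed.

Lemma row_spectral (R : realType) (n : nat) (S : 'M[R]_n) (x : 'rV[R]_n) i :
  row i (S *m diag_mx x *m invmx S) = hadamard (row i S) x *m invmx S.
Proof.
rewrite !row_mul; congr (_ *m _).
by apply/rowP => j; rewrite mul_mx_diag !mxE.
Qed.

Lemma spectraconeP (R : realType) (n : nat) (S : 'M[R]_n) (x : 'rV[R]_n) :
  S \in unitmx ->
  spectracone S x <-> forall i, row_cone S (hadamard (row i S) x).
Proof.
move=> uS; split=> [/mxOverP x_ge0 i|x_ge0].
  apply/row_coneP => //; rewrite -row_spectral.
  by apply/mxOverP => k j; rewrite mxE.
apply/mxOverP => i j.
have /row_coneP -/(_ uS)/mxOverP/(_ 0 j) := x_ge0 i.
by rewrite -row_spectral mxE.
Qed.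

Lemma row_cone_row (R : realType) (n : nat) (S : 'M[R]_n) (i : 'I_n) :
  row_cone S (row i S).
Proof.
exists (fun j => (j == i)%:R) => [j|]; first exact: ler0n.
rewrite (bigD1 i) //= eqxx scale1r big1 ?addr0 // => j /negPf ->.
exact: scale0r.
Qed.

(** Holds because [S *m diag_mx x *m invmx S] is linear in [x]. *)
Lemma spectracone_comb (R : realType) (n : nat) (S : 'M[R]_n) (c : 'I_n -> R)
    (x : 'I_n -> 'rV[R]_n) :
  (forall i, 0 <= c i) -> (forall i, spectracone S (x i)) ->
  spectracone S (\sum_i c i *: x i).
Proof.
move=> c_ge0 x_ge0; rewrite /spectracone /= linear_sum /= mulmx_sumr mulmx_suml.
apply/mxOverP => k j; rewrite summxE rpred_sum // => i _.
rewrite linearZ /= -scalemxAr -scalemxAl mxE rpredM ?nnegrE //.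
by have /mxOverP/(_ k j) := x_ge0 i.
Qed.

Theorem theorem3p7 (R : realType) (n : nat) (S : 'M[R]_n)
    (hS : perron_similarity S)
    (hrow : exists i : 'I_n, row i S = const_mx 1) :
  spectracone S = row_cone S <-> row_hadamard_conic S.
Proof.
have [uS _] := hS; have [e re] := hrow.
split=> [eqC i j|rhc].
  (* The criterion [spectraconeP] for [row j S], read at index [i], is the conic condition for the
     pair [i], [j]. *)
  have : spectracone S (row j S) by rewrite eqC; apply: row_cone_row.
  by move/spectraconeP => /(_ uS); apply.
apply/seteqP; split=> x.
  (* Here [e] is the index of the all-ones row, the unit of the Hadamard product. *)
  move=> /spectraconeP -/(_ uS)/(_ e); rewrite re.
  suff -> : hadamard (const_mx 1) x = x by [].
  by apply/rowP => j; rewrite !mxE mul1r.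
(* It suffices to treat the generators [row j S]. *)
move=> [c c_ge0 ->]; apply: spectracone_comb => // j.
by apply/spectraconeP => // i; apply: rhc.
Qed.
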